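(* Let $(R,\mathfrak m)$ be a complete local domain and let $B$ be a balanced big Cohen-Macaulay $R$-module. For finitely generated $R$-modules $N\subseteq M$, define $N^\natural_M$ to be the set of all $u\in M$ such that for all $b\in B$ we have $b\otimes u\in\operatorname{Im}(B\otimes_R N\to B\otimes_R M)$. Then for all finitely generated $R$-modules $N$, $M$, $W$ with $N\subseteq M$ the following hold: (1) $N^\natural_M$ is a submodule of $M$ containing $N$. (2) $(N^\natural_M)^\natural_M=N^\natural_M$. (3) If $N\subseteq M\subseteq W$, then $N^\natural_W\subseteq M^\natural_W$. (4) If $f:M\to W$ is an $R$-module homomorphism, then $f(N^\natural_M)\subseteq f(N)^\natural_W$. (5) If $N^\natural_M=N$, then $0^\natural_{M/N}=0$. (6) $\mathfrak m^\natural_R=\mathfrak m$ and $0^\natural_R=0$. (7) If $x_1,\ldots,x_{k+1}$ is a partial system of parameters for $R$, $J=(x_1,\ldots,x_k)$, $f:M\to R/J$ is a surjective homomorphism, and $v\in M$ satisfies $f(v)=x_{k+1}+J$, then $(Rv)^\natural_M\cap\ker f\subseteq (Jv)^\natural_M$.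
   Context: Local rings are Noetherian. A partial system of parameters is a sequence that forms part of a system of parameters of $R$. A balanced big Cohen-Macaulay module over $(R,\mathfrak m)$ is a (not necessarily finitely generated) $R$-module $B$ such that every system of parameters of $R$ is a regular sequence on $B$, i.e., whenever $x_1,\ldots,x_{k+1}$ is part of a system of parameters of $R$ and $b\in B$ satisfies $x_{k+1}b\in (x_1,\ldots,x_k)B$, then $b\in (x_1,\ldots,x_k)B$, and moreover $\mathfrak mB\neq B$. *)

(* Defs.v *)
From HB Require Import structures.
From mathcomp Require Import all_boot all_algebra.
From mathcomp Require Import boolp.
From mathcomp Require Import freeg.

Set Implicit Arguments.
Unset Strict Implicit.
Unset Printing Implicit Defensive.

Import GRing.Theory.
Local Open Scope ring_scope.
Local Open Scope quotient_scope.

(* A submodule of an R-module M is an element of [submodClosed M], and an     *)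
(* ideal of R is a submodule of the regular module R^o.                       *)

Section Submodules.
Variables (R : comNzRingType) (M : lmodType R).
Implicit Types (S : {pred M}) (I : {pred R^o}).

Definition Submod S (clS : submod_closed S) : submodClosed M :=
  HB.pack_for (submodClosed M) S (GRing.isSubmodClosed.Build R M S clS).

Fact span_subproof S : submod_closed
  [pred u | `[< forall P : {pred M},
    submod_closed P -> {subset S <= P} -> u \in P >]].
Proof.
split; first by apply/asboolP => P [].
move=> a u v /asboolP uS /asboolP vS; apply/asboolP => P clP SP.
by apply: clP.2; [apply: uS | apply: vS].
Qed.

Definition submod_span S : submodClosed M := Submod (span_subproof S).

(* I S: the submodule generated by the products r *: u (r in I, u in S). *)
Definition submod_mul I S : submodClosed M :=
  submod_span [pred z | `[< exists r u, [/\ r \in I, u \in S & z = r *: u] >]].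

Fact zero_submod_subproof : submod_closed (pred1 (0 : M)).
Proof.
split=> [|a u v]; rewrite !inE // => /eqP-> /eqP->.
by rewrite scaler0 addr0.
Qed.

Definition zero_submod : submodClosed M := Submod zero_submod_subproof.

Definition fin_gen S : Prop := exists s : seq M, S =i submod_span [in s].

End Submodules.

Fact submod_image_subproof (R : comNzRingType) (M W : lmodType R)
    (f : {linear M -> W}) (N : submodClosed M) :
  submod_closed [pred w | `[< exists2 u, u \in N & w = f u >]].
Proof.
split; first by apply/asboolP; exists 0; rewrite ?rpred0 ?raddf0.
move=> a _ _ /asboolP[u uN ->] /asboolP[v vN ->]; apply/asboolP.
by exists (a *: u + v); rewrite ?linearP // rpredD ?rpredZ.
Qed.

Definition submod_image (R : comNzRingType) (M W : lmodType R)
    (f : {linear M -> W}) (N : submodClosed M) : submodClosed W :=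
  Submod (submod_image_subproof f N).

Section SubAndQuotientModules.
Variables (R : comNzRingType) (M : lmodType R) (N : submodClosed M).

Record submodT := SubmodT { submod_val : M; submod_valP : submod_val \in N }.
HB.instance Definition _ := [isSub for submod_val].
HB.instance Definition _ := [Choice of submodT by <:].
HB.instance Definition _ := [SubChoice_isSubLmodule of submodT by <:].

Fact submod_zmod_closed : zmod_closed N.
Proof.
split=> [|u v uN vN]; first exact: rpred0.
by rewrite rpredD // -scaleN1r rpredZ.
Qed.

Definition submod_zmod : zmodClosed M :=
  HB.pack_for (zmodClosed M) (N : {pred M})
    (GRing.isZmodClosed.Build M (N : {pred M}) submod_zmod_closed).

(* The library only provides the additive group structure on M / N (and the   *)
(* ring structure when N is an ideal); the scalar action is added here.       *)
Definition quotmod := {ideal_quot submod_zmod}.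
HB.instance Definition _ := GRing.Zmodule.on quotmod.
HB.instance Definition _ := EqQuotient.on quotmod.

Lemma eq_quotmod u v : (u == v %[mod quotmod]) = (u - v \in N).
Proof. by rewrite -Quotient.idealrBE. Qed.

Definition quot_scale (a : R) := lift_op1 quotmod ( *:%R a).

Lemma pi_quot_scale a : {morph \pi_quotmod : u / a *: u >-> quot_scale a u}.
Proof.
move=> u; unlock quot_scale; apply/eqP.
by rewrite eq_quotmod -scalerBr rpredZ // -eq_quotmod reprK.
Qed.

Fact pi_quotD : {morph \pi_quotmod : u v / u + v}.
Proof. by move=> u v; rewrite [RHS]piE. Qed.

Fact quot_scaleA a b q : quot_scale a (quot_scale b q) = quot_scale (a * b) q.
Proof. by rewrite -[q]reprK -!pi_quot_scale scalerA. Qed.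

Fact quot_scale1 : left_id 1 quot_scale.
Proof. by move=> q; rewrite -[q]reprK -!pi_quot_scale scale1r. Qed.

Fact quot_scaleDr : right_distributive quot_scale +%R.
Proof.
move=> a p q; rewrite -[p]reprK -[q]reprK.
by rewrite -!(pi_quotD, pi_quot_scale) scalerDr.
Qed.

Fact quot_scaleDl q : {morph quot_scale^~ q : a b / a + b}.
Proof.
by move=> a b; rewrite -[q]reprK -!pi_quot_scale -pi_quotD scalerDl.
Qed.

HB.instance Definition _ := GRing.Zmodule_isLmodule.Build R quotmod
  quot_scaleA quot_scale1 quot_scaleDr quot_scaleDl.

Definition quot_pi (u : M) : quotmod := \pi_quotmod u.

Fact quot_pi_linear : linear quot_pi.
Proof. by move=> a u v; rewrite /quot_pi pi_quotD pi_quot_scale. Qed.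

HB.instance Definition _ :=
  GRing.isLinear.Build R M quotmod _ quot_pi quot_pi_linear.

Lemma quot_piK : cancel repr quot_pi.
Proof. exact: reprK. Qed.

Lemma eq_quot_pi u v : (quot_pi u == quot_pi v) = (u - v \in N).
Proof. exact: eq_quotmod. Qed.

Lemma quot_pi_eq0 u : (quot_pi u == 0) = (u \in N).
Proof. by rewrite -(raddf0 quot_pi) eq_quot_pi subr0. Qed.

End SubAndQuotientModules.

(* B \otimes_R M is the free R-module on B * M modulo the bilinear relations. *)
Section TensorProduct.
Variables (R : comNzRingType) (B M : lmodType R).
Local Notation free := {freeg (B * M)%type / R}.

Definition bilinear_rel : {pred free} :=
  [pred z | `[< (exists a b1 b2 u,
      z = << (a *: b1 + b2, u) >> - (a *: << (b1, u) >> + << (b2, u) >>))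
   \/ (exists a b u1 u2,
      z = << (b, a *: u1 + u2) >> - (a *: << (b, u1) >> + << (b, u2) >>)) >]].

Definition tensor : Type := quotmod (submod_span bilinear_rel).
HB.instance Definition _ := GRing.Lmodule.on tensor.

Definition tens (b : B) (u : M) : tensor :=
  quot_pi (submod_span bilinear_rel) << (b, u) >>.

Lemma bilinear_rel_span z :
  z \in bilinear_rel -> z \in submod_span bilinear_rel.
Proof. by move=> zr; apply/asboolP => P _; apply. Qed.

Fact tens_bilinear :
  bilinear_for (GRing.Scale.Law.clone _ _ *:%R _)
               (GRing.Scale.Law.clone _ _ *:%R _) tens.
Proof.
split=> [u a b1 b2|b a u1 u2]; apply/eqP; rewrite /tens -linearP eq_quot_pi;
  apply: bilinear_rel_span; apply/asboolP.
- by left; exists a, b1, b2, u.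
- by right; exists a, b, u1, u2.
Qed.

HB.instance Definition _ :=
  bilinear_isBilinear.Build R B M tensor _ _ tens tens_bilinear.

Section Lift.
Variables (V : lmodType R) (g : {bilinear B -> M -> V}).
Let h := fun p : B * M => g p.1 p.2.

Fact fglift_linear : linear (fglift h : free -> V).
Proof.
pose hA := GRing.isZmodMorphism.Build free V (fglift h) (lift_is_additive h).
pose F : {additive free -> V} := HB.pack_for {additive free -> V} (fglift h) hA.
rewrite -[fglift h]/(F : free -> V) => a D1 D2; rewrite raddfD; congr (_ + _).
rewrite -[D1 in RHS]freeg_sumE [a *: D1]/(fgscale a D1) !raddf_sum.
by apply: eq_bigr => z _; rewrite /= /F /= !liftU scalerA.
Qed.

Fact fglift_span z : z \in submod_span bilinear_rel -> fglift h z = 0.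
Proof.
have hl := fglift_linear.
move=> /asboolP/(_ [pred z | fglift h z == 0]) zP; apply/eqP; apply: zP.
  have h0 : fglift h 0 = 0.
    by rewrite -(subrr 0) (lift_is_additive h) subrr.
  split=> [|a u v]; rewrite !inE ?h0 // => /eqP u0 /eqP v0.
  by rewrite hl u0 v0 scaler0 addr0.
have hB u v : fglift h (u - v) = fglift h u - fglift h v.
  exact: lift_is_additive.
move=> {}z /asboolP[[a [b1 [b2 [u ->]]]]|[a [b [u1 [u2 ->]]]]];
  rewrite inE hB hl !liftU !scale1r /h /=.
- by rewrite linearPl subrr.
- by rewrite linearPr subrr.
Qed.

Definition tensor_lift (t : tensor) : V := fglift h (repr t).

Lemma tensor_lift_pi z :
  tensor_lift (quot_pi (submod_span bilinear_rel) z) = fglift h z.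
Proof.
apply/eqP; rewrite -subr_eq0 -(lift_is_additive h); apply/eqP.
by apply: fglift_span; rewrite -eq_quot_pi quot_piK.
Qed.

Lemma tensor_lift_tens b u : tensor_lift (tens b u) = g b u.
Proof. by rewrite tensor_lift_pi liftU scale1r. Qed.

Fact tensor_lift_linear : linear tensor_lift.
Proof.
move=> a t t'; rewrite -[t]quot_piK -[t']quot_piK -linearP !tensor_lift_pi.
exact: fglift_linear.
Qed.

HB.instance Definition _ :=
  GRing.isLinear.Build R tensor V _ tensor_lift tensor_lift_linear.

End Lift.

End TensorProduct.

(* id_B \otimes f : B \otimes N -> B \otimes M *)
Section TensorMap.
Variables (R : comNzRingType) (B N M : lmodType R) (f : {linear N -> M}).

Definition tens_comp (b : B) (u : N) : tensor B M := tens b (f u).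

Fact tens_comp_bilinear :
  bilinear_for (GRing.Scale.Law.clone _ _ *:%R _)
               (GRing.Scale.Law.clone _ _ *:%R _) tens_comp.
Proof.
split=> [u a b1 b2|b a u1 u2]; rewrite /tens_comp.
- exact: linearPl.
- by rewrite linearP; exact: linearPr.
Qed.

HB.instance Definition _ :=
  bilinear_isBilinear.Build R B N (tensor B M) _ _ tens_comp tens_comp_bilinear.

Definition tensor_map : {linear tensor B N -> tensor B M} :=
  tensor_lift tens_comp.

Lemma tensor_map_tens b u : tensor_map (tens b u) = tens b (f u).
Proof. exact: tensor_lift_tens. Qed.

End TensorMap.

(* N^natural_M: the u such that every b \otimes u lies in the image of        *)
(* B \otimes N -> B \otimes M.                                                *)
Definition natcl (R : comNzRingType) (B M : lmodType R) (N : submodClosed M) :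
    {pred M} :=
  [pred u | `[< forall b : B, exists t : tensor B (submodT N),
    tensor_map B (\val : {linear submodT N -> M}) t = tens b u >]].

Section LocalAlgebra.
Variable R : comNzRingType.
Implicit Types (I J P : {pred R}) (m : submodClosed R^o) (x : seq R) (k : nat).

Definition noetherian : Prop := forall I : submodClosed R^o, fin_gen I.

(* [idealr_closed] includes properness. *)
Definition maximal_ideal I : Prop :=
  idealr_closed I /\
  forall J, idealr_closed J -> {subset I <= J} -> J =i I.

Definition prime_ideal P : Prop := idealr_closed P /\ prime_idealr_closed P.

Fixpoint ideal_exp (I : {pred R^o}) k : {pred R^o} :=
  if k is k'.+1 then submod_mul I (ideal_exp I k') else predT.

(* R -> lim R/m^k is bijective: R is m-adically separated, and every          *)
(* m-adic Cauchy sequence converges.                                          *)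
Definition adically_complete m : Prop :=
  (forall r : R, (forall k, r \in ideal_exp m k) -> r = 0) /\
  (forall u : nat -> R,
    (forall k, exists n, forall i j, (n <= i)%N -> (n <= j)%N ->
       u i - u j \in ideal_exp m k) ->
    exists l : R, forall k, exists n, forall i, (n <= i)%N ->
       u i - l \in ideal_exp m k).

Record complete_local_ring m : Prop := CompleteLocalRing {
  complete_local_noetherian : noetherian;
  complete_local_maximal : maximal_ideal m;
  complete_local_unique : forall I, maximal_ideal I -> I =i m;
  complete_local_complete : adically_complete m
}.

(* There is a chain P 0 < P 1 < ... < P k of prime ideals. *)
Definition prime_chain k : Prop := exists P : nat -> {pred R},
  (forall i, (i <= k)%N -> prime_ideal (P i)) /\
  (forall i, (i < k)%N ->
     {subset P i <= P i.+1} /\ ~ {subset P i.+1 <= P i}).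

Definition krull_dim d : Prop :=
  prime_chain d /\ forall k, prime_chain k -> (k <= d)%N.

Definition ideal_gen x : submodClosed R^o := @submod_span R R^o [in x].

Definition radical I : {pred R} := [pred r | `[< exists k, r ^+ k \in I >]].

(* x consists of dim R elements generating an m-primary ideal. *)
Definition sop m x : Prop :=
  krull_dim (size x) /\ radical (ideal_gen x) =i m.

Definition partial_sop m x : Prop := exists y, sop m (x ++ y).

Definition balanced_big_CM m (B : lmodType R) : Prop :=
  (forall x y (b : B), partial_sop m (rcons x y) ->
     y *: b \in submod_mul (ideal_gen x) (predT : {pred B}) ->
     b \in submod_mul (ideal_gen x) (predT : {pred B})) /\
  ~ (submod_mul m (predT : {pred B}) =i predT).

End LocalAlgebra.

(* Main.v *)
Require Import Defs.
From HB Require Import structures.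
From mathcomp Require Import all_boot all_algebra.
From mathcomp Require Import boolp classical_sets freeg ring.

Set Implicit Arguments.
Unset Strict Implicit.
Unset Printing Implicit Defensive.

Import GRing.Theory.
Local Open Scope ring_scope.

(* B (x) N and the pure tensors b (x) n with n in N have the same image in    *)
(* B (x) M, so (1)-(4) hold for any B; (5) is the right exactness of B (x) -, *)
(* and (7) reads off the regularity of x_{k+1} on B / J B = B (x) R / J. In   *)
(* (6), R is a domain, so a nonzero u in m starts a system of parameters and  *)
(* is therefore a nonzerodivisor on B: the closure of 0 is 0. That u extends  *)
(* to a system of parameters rests on prime avoidance and on Krull's height   *)
(* theorem.                                                                   *)

(** Let T(N) be the image of B (x) N in B (x) M. It is spanned by the b (x) n with n in N, so u lies
    in the closure of N iff every b (x) u lies in T(N) ([natclP]). This condition is linear in u, T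
    is monotone and functorial, and N and its closure have the same T: hence (1)-(4). For (5), b (x)
    u vanishing in B (x) M/N puts b (x) u in T(N) ([tens_quot_eq0]).

    For (6), b (x) r -> r b sends T(I) into IB, so r in the closure of I gives rB inside IB
    ([natcl_ideal]). A unit in the closure of m would give mB = B. A nonzero u in the closure of 0
    kills B; being a unit or a parameter it is injective on B, so B = 0 = mB. For (7), each b (x) u
    equals some b' (x) v; applying f gives y b' = 0 in B/JB, so b' is in JB and b' (x) v is in
    T(Jv).

    The commutative algebra shows that a nonzero u in m is a parameter ([partial_sop1]). Prime
    avoidance keeps adjoining elements of m until the ideal is m-primary; each one lengthens a chain
    of primes below m, and the height theorem ([pchain_height]) forbids longer chains, so the number
    of elements is dim R. *)

Section Span.
Variables (R : comNzRingType) (M : lmodType R).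
Implicit Types (S : {pred M}) (N : submodClosed M).

Lemma mem_submod_span S u : u \in S -> u \in submod_span S.
Proof. by move=> Su; apply/asboolP => P _; apply. Qed.

Lemma submod_closed_mem N : submod_closed N.
Proof. by split=> [|a u v Nu Nv]; [exact: rpred0 | rewrite rpredD ?rpredZ]. Qed.

Lemma submod_span_sub S N :
  {subset S <= N} -> {subset submod_span S <= N}.
Proof. by move=> SN u /asboolP; apply=> //; exact: submod_closed_mem. Qed.

Lemma mem_submod_mul (I : {pred R^o}) S r u :
  r \in I -> u \in S -> r *: u \in submod_mul I S.
Proof.
by move=> Ir Su; apply/mem_submod_span/asboolP; exists r, u.
Qed.

Lemma mem_zero_submod (u : M) : (u \in zero_submod M) = (u == 0).
Proof. by []. Qed.

End Span.

Lemma submod_span_preim (R : comNzRingType) (M V : lmodType R) (f : M -> V)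
    (S : submodClosed V) (A : {pred M}) :
  linear f -> (forall u, u \in A -> f u \in S) ->
  forall u, u \in submod_span A -> f u \in S.
Proof.
move=> fL AS; pose F : {linear M -> V} :=
  HB.pack_for {linear M -> V} f (GRing.isLinear.Build R M V _ f fL).
have clF : submod_closed [pred u | f u \in S].
  split=> [|a u v]; rewrite !inE -[f]/(F : M -> V) ?raddf0 ?rpred0 // => Su Sv.
  by rewrite linearP rpredD ?rpredZ.
by move=> u; apply: (submod_span_sub (N := Submod clF)).
Qed.

(** * Pure tensors and the image of B (x) N *)

Section TensorSpan.
Variables (R : comNzRingType) (B M : lmodType R).

Lemma tensPl a (b b' : B) (u : M) :
  tens (a *: b + b') u = a *: tens b u + tens b' u.
Proof. exact: linearPl. Qed.

Lemma tensPr a (b : B) (u u' : M) :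
  tens b (a *: u + u') = a *: tens b u + tens b u'.
Proof. exact: linearPr. Qed.

Lemma tensor_lin_ind (V : lmodType R) (f : {linear tensor B M -> V})
    (S : submodClosed V) :
  (forall b u, f (tens b u) \in S) -> forall t, f t \in S.
Proof.
move=> tS t; rewrite -[t]quot_piK -[repr t]freeg_sumE !linear_sum.
apply: rpred_sum => -[b u] _.
have fgZ k : << k *g (b, u) >> =
    k *: << (b, u) >> :> {freeg (B * M)%type / R}.
  apply/eqP/freeg_eqP => z.
  by rewrite coeffU [RHS]coeff_fgscale coeffU mul1r.
by rewrite fgZ 2!linearZ rpredZ //; exact: tS.
Qed.

End TensorSpan.

Section TensorImage.
Variables (R : comNzRingType) (B M : lmodType R).

(** The image of B (x) N, described inside B (x) M so that B (x) N itself need not be handled;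
    [natclP] makes the link. *)
Definition tens_im (N : {pred M}) : submodClosed (tensor B M) :=
  submod_span [pred t | `[< exists b n, n \in N /\ t = tens b n >]].

Lemma mem_tens_im (N : {pred M}) b n : n \in N -> tens b n \in tens_im N.
Proof. by move=> Nn; apply/mem_submod_span/asboolP; exists b, n. Qed.

Lemma tens_im_sub (N : {pred M}) (S : submodClosed (tensor B M)) :
  (forall b n, n \in N -> tens b n \in S) -> {subset tens_im N <= S}.
Proof.
by move=> NS; apply: submod_span_sub => _ /asboolP[b [n [Nn ->]]]; exact: NS.
Qed.

Lemma natclP (N : submodClosed M) (u : M) :
  (u \in natcl B N) <-> (forall b, tens b u \in tens_im N).
Proof.
set val_ := (\val : {linear submodT N -> M}).
split=> [/asboolP uN b|uN]; last first.
  apply/asboolP => b; have := uN b.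
  pose F := tensor_map B val_.
  have Fcl : submod_closed [pred w | `[< exists t, F t = w >]].
    split; first by apply/asboolP; exists 0; rewrite raddf0.
    move=> a _ _ /asboolP[t <-] /asboolP[t' <-]; apply/asboolP.
    by exists (a *: t + t'); rewrite linearP.
  move/(tens_im_sub (S := Submod Fcl)) => /(_ _)/asboolP; apply.
  move=> {}b n Nn; apply/asboolP; exists (tens b (SubmodT Nn)).
  exact: tensor_map_tens.
have [t <-] := uN b.
apply: (tensor_lin_ind (f := tensor_map B val_)) => {}b n.
rewrite tensor_map_tens; apply: mem_tens_im.
exact: submod_valP.
Qed.

End TensorImage.

(** * Formal properties of the closure, for any B *)

Section NatClosure.
Variables (R : comNzRingType) (B : lmodType R).

Lemma natcl_submod_closed (M : lmodType R) (N : submodClosed M) :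
  submod_closed (natcl B N).
Proof.
split; first by apply/natclP => b; rewrite linear0r rpred0.
move=> a u v /natclP uN /natclP vN; apply/natclP => b.
by rewrite tensPr rpredD ?rpredZ.
Qed.

Lemma sub_natcl (M : lmodType R) (N : submodClosed M) :
  {subset N <= natcl B N}.
Proof. by move=> u Nu; apply/natclP => b; exact: mem_tens_im. Qed.

Lemma natcl_idem (M : lmodType R) (N : submodClosed M)
    (clN : submod_closed (natcl B N)) :
  natcl B (Submod clN) =i natcl B N.
Proof.
move=> u; apply/idP/idP => [/natclP uN|/natclP uN]; apply/natclP => b.
  by move: (uN b); apply: tens_im_sub => {}b n /natclP.
by move: (uN b); apply: tens_im_sub => {}b n /sub_natcl/mem_tens_im.
Qed.

Lemma natcl_mono (W : lmodType R) (N M : submodClosed W) :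
  {subset N <= M} -> {subset natcl B N <= natcl B M}.
Proof.
move=> NM u /natclP uN; apply/natclP => b; move: (uN b).
by apply: tens_im_sub => {}b n /NM/mem_tens_im.
Qed.

Lemma natcl_image (M W : lmodType R) (N : submodClosed M)
    (f : {linear M -> W}) u :
  u \in natcl B N -> f u \in natcl B (submod_image f N).
Proof.
move=> /natclP uN; apply/natclP => b; rewrite -(tensor_map_tens f).
apply: submod_span_preim (linearP _) _ _ (uN b) => _ /asboolP[{}b [n [Nn ->]]].
by rewrite tensor_map_tens; apply/mem_tens_im/asboolP; exists n.
Qed.

End NatClosure.

(** * Right exactness and the closure over quotients and ideals *)

Section QuotientBilinear.
Variables (R : comNzRingType) (B M V : lmodType R).
Variables (g : {bilinear B -> M -> V}).
Variables (N : submodClosed M) (S : submodClosed V).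
Hypothesis gNS : forall b n, n \in N -> g b n \in S.

(** The map B x M/N -> V/S induced by [g]. The proof that makes it well defined is an argument of
    the term, so that the bilinear structure can be inferred from it. *)
Definition quot_bilin (_ : forall b n, n \in N -> g b n \in S)
  (b : B) (q : quotmod N) : quotmod S := quot_pi S (g b (repr q)).

Lemma quot_bilin_pi b u : quot_bilin gNS b (quot_pi N u) = quot_pi S (g b u).
Proof.
apply/eqP; rewrite eq_quot_pi -linearBr gNS // -eq_quot_pi.
by rewrite quot_piK.
Qed.

Lemma quot_bilin_bilinear :
  bilinear_for (GRing.Scale.Law.clone _ _ *:%R _)
               (GRing.Scale.Law.clone _ _ *:%R _) (quot_bilin gNS).
Proof.
split=> [q a b1 b2|b a q1 q2].
  by rewrite /quot_bilin linearPl linearP.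
rewrite -[q1]quot_piK -[q2]quot_piK -linearP !quot_bilin_pi linearPr.
by rewrite linearP.
Qed.

HB.instance Definition _ :=
  bilinear_isBilinear.Build R B (quotmod N) (quotmod S) _ _ (quot_bilin gNS)
    quot_bilin_bilinear.

(* With g the tensor product and S the image of B (x) N, this is the          *)
(* nontrivial half of the right exactness of B (x) -.                         *)
Lemma tens_quot_eq0 b u : tens b (quot_pi N u) = 0 -> g b u \in S.
Proof.
move=> tbu0; rewrite -quot_pi_eq0 -quot_bilin_pi.
by rewrite -(tensor_lift_tens (quot_bilin gNS)) tbu0 raddf0.
Qed.

End QuotientBilinear.

Section Quotient.
Variables (R : comNzRingType) (B : lmodType R).

Lemma tens_im0 (M : lmodType R) t : t \in tens_im B (zero_submod M) -> t = 0.
Proof.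
move=> t0; apply/eqP; rewrite -mem_zero_submod; move: t t0.
by apply: tens_im_sub => b n /eqP->; rewrite linear0r inE.
Qed.

Lemma natcl_quot0 (M : lmodType R) (N : submodClosed M) :
  natcl B N =i N ->
  natcl B (zero_submod (quotmod N)) =i zero_submod (quotmod N).
Proof.
move=> clN q; apply/idP/idP; last exact: sub_natcl.
rewrite mem_zero_submod -[q]quot_piK quot_pi_eq0 -clN => /natclP q0.
apply/natclP => b.
apply: (tens_quot_eq0 (g := @tens R B M)) (tens_im0 (q0 b)) => b' n.
exact: mem_tens_im.
Qed.

Definition scale_bilin (b : B) (r : R^o) : B := (r : R) *: b.

Lemma scale_bilin_bilinear :
  bilinear_for (GRing.Scale.Law.clone _ _ *:%R _)
               (GRing.Scale.Law.clone _ _ *:%R _) scale_bilin.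
Proof.
split=> [r a b1 b2|b a r1 r2]; rewrite /scale_bilin /=.
  by rewrite scalerDr !scalerA mulrC.
by rewrite scalerDl -scalerA.
Qed.

HB.instance Definition _ :=
  bilinear_isBilinear.Build R B R^o B _ _ scale_bilin scale_bilin_bilinear.

Lemma natcl_ideal (I : submodClosed R^o) (r : R^o) b :
  r \in natcl B I -> (r : R) *: b \in submod_mul I (predT : {pred B}).
Proof.
move=> /natclP/(_ b) rI; rewrite -/(scale_bilin b r) -tensor_lift_tens.
apply: submod_span_preim (linearP _) _ _ rI => _ /asboolP[{}b [n [In ->]]].
by rewrite [X in X \in _]tensor_lift_tens; apply: mem_submod_mul.
Qed.

(** Scalars move across the tensor sign, so the pure tensors b (x) v with v fixed already form a
    submodule. *)
Lemma tens_im_span1 (M : lmodType R) (v : M) (t : tensor B M) :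
  t \in tens_im B (submod_span (pred1 v)) -> exists b, t = tens b v.
Proof.
have cl1 : submod_closed [pred t | `[< exists b : B, t = tens b v >]].
  split; first by apply/asboolP; exists 0; rewrite linear0l.
  move=> a _ _ /asboolP[b ->] /asboolP[b' ->]; apply/asboolP.
  by exists (a *: b + b'); rewrite tensPl.
move=> tv; apply/asboolP; move: t tv; apply: (tens_im_sub (S := Submod cl1)).
move=> b; apply: (submod_span_preim (S := Submod cl1)) => [a u u'|u].
  exact: tensPr.
by move=> /eqP->; apply/asboolP; exists b.
Qed.

(* A representative [b' (x) v] of [b (x) u] maps to [y b' = 0] in B / J B.   *)
Lemma natcl_span1_colon (J : submodClosed R^o) (y : R) (M : lmodType R)
    (f : {linear M -> quotmod J}) (v : M) :
  (forall b : B, y *: b \in submod_mul J (predT : {pred B}) ->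
     b \in submod_mul J (predT : {pred B})) ->
  f v = quot_pi J y ->
  forall u, u \in natcl B (submod_span (pred1 v)) -> f u = 0 ->
    u \in natcl B (submod_mul J (pred1 v)).
Proof.
move=> yreg fv u /natclP uv fu0; apply/natclP => b.
have [b' tbu] := tens_im_span1 (uv b).
have JB c r : r \in J -> scale_bilin c r \in submod_mul J (predT : {pred B}).
  by move=> Jr; exact: mem_submod_mul.
have /yreg b'J : y *: b' \in submod_mul J (predT : {pred B}).
  apply: (tens_quot_eq0 (g := scale_bilin) JB (u := y)).
  by rewrite -fv -tensor_map_tens -tbu tensor_map_tens fu0 linear0r.
pose tv (c : B) := tens c v.
have tvL : linear tv by move=> a c c'; exact: tensPl.
rewrite tbu -/(tv b'); apply: (submod_span_preim tvL) b'J.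
move=> _ /asboolP[r [c [Jr _ ->]]].
have -> : tv (r *: c) = tens c (r *: v).
  by rewrite /tv linearZl_LR /= linearZr_LR.
by apply/mem_tens_im/mem_submod_mul; rewrite ?inE.
Qed.

End Quotient.

(** * Krull's height theorem *)

Section Ideals.
Local Open Scope classical_set_scope.
Variable R : comNzRingType.
Implicit Types (I J K A P Q : set R) (a b c r s t x y : R).

(** Unlike [idealr_closed], this admits the unit ideal. *)
Definition ideal I := I 0 /\ forall a u v, I u -> I v -> I (a * u + v).

Definition prime P :=
  [/\ ideal P, ~ P 1 & forall a b, P (a * b) -> P a \/ P b].

Section IdealTheory.
Variable I : set R.
Hypothesis idI : ideal I.

Lemma ideal0 : I 0. Proof. exact: idI.1. Qed.
Lemma idealM a u : I u -> I (a * u).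
Proof.
by move=> Iu; rewrite -[a * u]addr0; apply: idI.2 => //; exact: ideal0.
Qed.

Lemma idealD u v : I u -> I v -> I (u + v).
Proof. by move=> Iu Iv; rewrite -[u]mul1r; apply: idI.2. Qed.
Lemma idealN u : I u -> I (- u).
Proof. by rewrite -mulN1r; exact: idealM. Qed.
Lemma idealB u v : I u -> I v -> I (u - v).
Proof. by move=> Iu Iv; apply: idealD => //; exact: idealN. Qed.
Lemma idealBl u v : I (u - v) -> I v -> I u.
Proof. by move=> Iuv Iv; rewrite -[u](subrK v); exact: idealD. Qed.
Lemma idealBr u v : I (u - v) -> I u -> I v.
Proof. by move=> Iuv Iu; rewrite -[v](subKr u); exact: idealB. Qed.

End IdealTheory.

Lemma prime_is_ideal P : prime P -> ideal P. Proof. by case. Qed.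

Lemma primeX P a n : prime P -> P (a ^+ n) -> P a.
Proof.
case=> _ P1 PM; elim: n => [/P1 //|n IHn].
by rewrite exprS => /PM[|/IHn].
Qed.

Lemma ideal_colon I g : ideal I -> ideal [set r | I (r * g)].
Proof.
move=> idI; split=> /= [|a u v Iu Iv]; first by rewrite mul0r; exact: ideal0.
by rewrite mulrDl -mulrA; apply: idI.2.
Qed.

Definition add_gen I g : set R := [set r | exists c, I (r - c * g)].

Lemma ideal_add_gen I g : ideal I -> ideal (add_gen I g).
Proof.
move=> idI; split=> [|a u v [c Ic] [d Id]].
  by exists 0; rewrite mul0r subr0; exact: ideal0.
exists (a * c + d).
rewrite (_ : _ - _ = a * (u - c * g) + (v - d * g)); last by ring.
exact: idI.2.
Qed.

Lemma sub_add_gen I g : I `<=` add_gen I g.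
Proof. by move=> r Ir; exists 0; rewrite mul0r subr0. Qed.

Lemma add_gen_id I g : ideal I -> add_gen I g g.
Proof. by move=> idI; exists 1; rewrite mul1r subrr; exact: ideal0. Qed.

Lemma add_gen_sub I J g : ideal J -> I `<=` J -> J g -> add_gen I g `<=` J.
Proof.
move=> idJ IJ Jg r [c /IJ Jr]; apply: (idealBl idJ Jr).
exact: idealM.
Qed.

Lemma add_gen_mul I a b u v :
  ideal I -> I (a * b) -> add_gen I a u -> add_gen I b v -> I (u * v).
Proof.
move=> idI Iab [c Iu] [d Iv].
rewrite (_ : u * v = v * (u - c * a) + (c * a * (v - d * b) + c * d * (a * b)));
  last by ring.
by apply: idI.2 => //; apply: idealD => //; exact: idealM.
Qed.

(* The contraction to R of the extension of I to the localisation at P.       *)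
Definition sat P I : set R := [set r | exists2 s, ~ P s & I (s * r)].

Lemma ideal_sat P I : prime P -> ideal I -> ideal (sat P I).
Proof.
move=> [idP P1 PM] idI; split=> [|a u v [s Ps Iu] [t Pt Iv]].
  by exists 1 => //; rewrite mulr0; exact: ideal0.
exists (s * t) => [/PM[]//|].
rewrite (_ : _ * _ = (a * t) * (s * u) + s * (t * v)); last by ring.
by apply: idI.2 => //; exact: idealM.
Qed.

Lemma sub_sat P I : prime P -> I `<=` sat P I.
Proof. by move=> [_ P1 _] r Ir; exists 1; rewrite ?mul1r. Qed.

Lemma sat_mul P I s r : prime P -> ~ P s -> sat P I (s * r) -> sat P I r.
Proof.
move=> [_ _ PM] Ps [t Pt Itr]; exists (t * s); last by rewrite -mulrA.
by move/PM => [].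
Qed.

End Ideals.

(** * Noetherian induction and the principal ideal theorem *)

Section Noetherian.
Local Open Scope classical_set_scope.
Variable R : comNzRingType.
Hypothesis noethR : noetherian R.
Implicit Types (I J K A P Q : set R) (a b c r s t x y : R).

Lemma ideal_chain_stable (I : nat -> set R) :
  (forall n, ideal (I n)) -> (forall n, I n `<=` I n.+1) ->
  exists n, forall k, I k `<=` I n.
Proof.
move=> idI Iinc.
have Imono n k : (n <= k)%N -> I n `<=` I k.
  by move=> /subnK<-; elim: (k - n)%N => // i IHi r /IHi/Iinc.
have clU : submod_closed ([pred r | `[< exists n, I n r >]] : {pred R^o}).
  split; first by apply/asboolP; exists 0%N; exact: ideal0 (idI _).
  move=> a u v /asboolP[i Iu] /asboolP[j Iv]; apply/asboolP.
  exists (maxn i j); apply: (idI _).2.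
    exact: Imono (leq_maxl _ _) _ Iu.
  exact: Imono (leq_maxr _ _) _ Iv.
have [s sU] := noethR (Submod clU).
have [n sI] : exists n, forall r, r \in s -> I n r.
  have sU' r : r \in s -> exists n, I n r.
    move=> sr; have : r \in Submod clU.
      by rewrite sU; apply/asboolP => P _; apply.
    by move/asboolP.
  elim: s sU' {sU} => [|r s IHs] sU; first by exists 0%N.
  have [|n In] := IHs; first by move=> t st; apply: sU; rewrite inE st orbT.
  have [|k Ik] := sU r; first by rewrite mem_head.
  exists (maxn n k) => t; rewrite inE => /predU1P[->|/In].
    exact: Imono (leq_maxr _ _) _ Ik.
  exact: Imono (leq_maxl _ _) _.
exists n => k r Ikr.
have : r \in Submod clU by apply/asboolP; exists k.
rewrite sU => /asboolP/(_ [pred r | `[< I n r >]]) H; apply/asboolP/H.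
  split=> [|a u v /asboolP Iu /asboolP Iv]; apply/asboolP.
    exact: ideal0 (idI n).
  exact: (idI n).2.
by move=> t st; apply/asboolP/sI.
Qed.

Lemma noetherian_ind (Pr : set R -> Prop) :
  (forall I, ideal I ->
     (forall J, ideal J -> I `<=` J -> ~ J `<=` I -> Pr J) -> Pr I) ->
  forall I, ideal I -> Pr I.
Proof.
move=> IH I idI; apply: contrapT => PrI.
pose bad := {J : set R | ideal J /\ ~ Pr J}.
have step (J : bad) :
    exists K : bad, sval J `<=` sval K /\ ~ sval K `<=` sval J.
  case: J => J [idJ PrJ] /=; apply: contrapT => H.
  apply/PrJ/IH => // K idK JK KJ.
  by apply: contrapT => PrK; apply: H; exists (exist _ K (conj idK PrK)).
have [f fP] := choice step.
pose J n := sval (iter n f (exist _ I (conj idI PrI))).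
have [|n|n Jn] := @ideal_chain_stable J.
- by move=> n; exact: (svalP (iter n f _)).1.
- exact: (fP _).1.
- exact: (fP (iter n f _)).2 (Jn n.+1).
Qed.

(** If ab is in (I : g) but a and b are not, then (I : bg) is strictly larger, as it contains a, and
    is still proper. Noetherian induction on the colon ideal ends at a prime. *)
Lemma ass_prime I g : ideal I -> ~ I g ->
  exists2 h, ~ I h & prime [set r | I (r * h)].
Proof.
move=> idI; suff H : forall K, ideal K -> forall g, ~ I g ->
    [set r | I (r * g)] = K -> exists2 h, ~ I h & prime [set r | I (r * h)].
  by move=> Ig; apply: H (ideal_colon g idI) g Ig erefl.
apply: noetherian_ind => K idK IH {}g Ig gK.
apply: contrapT => noh.
have [prg|nprg] := pselect (prime [set r | I (r * g)]).
  by apply: noh; exists g.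
apply: nprg; split=> [||a b /= Iabg]; first exact: ideal_colon.
  by rewrite /= mul1r.
apply: contrapT => /not_orP[Iag Ibg]; apply: noh.
apply: (IH _ (ideal_colon (b * g) idI) _ _ (b * g)) => //= [r|].
  by rewrite -gK /= => Irg; rewrite mulrCA; exact: idealM.
by move=> /(_ a); rewrite -gK /= mulrA => /(_ Iabg).
Qed.

(* Noetherian induction on K: the local ring R_P / K has finite length when P *)
(* is minimal over K.                                                         *)
Lemma dcc_over_minimal_prime K P : ideal K -> prime P ->
  (forall P', prime P' -> K `<=` P' -> P' `<=` P -> P `<=` P') ->
  forall L : nat -> set R, (forall n, ideal (L n)) ->
    (forall n, K `<=` L n) -> (forall n, L n.+1 `<=` L n) ->
  exists n, L n `<=` sat P (L n.+1).
Proof.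
move=> idK prP; have [idP P1 PM] := prP; move: K idK.
apply: noetherian_ind => K idK IH minP L idL KL Ldec.
have Lmono i j : (i <= j)%N -> L j `<=` L i.
  by move=> /subnK<-; elim: (j - i)%N => // k IHk r /Ldec/IHk.
have [[s [Ks Ps]]|KP] := pselect (exists s, K s /\ ~ P s).
  exists 0%N => r _; exists s => //; rewrite mulrC; apply: idealM => //.
  exact: KL.
have idS := ideal_sat prP idK.
have [|g Sg prg] := @ass_prime _ 1 idS.
  by move=> [s Ps]; rewrite mulr1 => Ks; apply: KP; exists s.
(* The prime colon ideal of [g] contains K and lies in P, so by minimality it contains P. *)
have Pg r : P r -> sat P K (r * g).
  apply: minP prg _ _ r => [r Kr|r /= Srg].
    by apply: sub_sat => //; rewrite mulrC; exact: idealM.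
  by apply: contrapT => Pr; apply: Sg; exact: sat_mul Pr Srg.
have Lg N : exists2 n, (N <= n)%N & L n `<=` sat P (add_gen (L n.+1) g).
  have [|||n|n r [c Kr]|n r [c Lr]|n Ln] := IH _ (ideal_add_gen g idK) _ _ _
    (fun n => add_gen (L (N + n)%N) g).
  - exact: sub_add_gen.
  - by move=> /(_ g (add_gen_id g idK)) Kg; apply: Sg; exact: sub_sat.
  - by move=> P' prP' KP'; apply: minP => // r Kr; apply/KP'/sub_add_gen.
  - exact: ideal_add_gen.
  - by exists c; exact: KL.
  - by exists c; apply: Ldec; rewrite -addnS.
  - exists (N + n)%N; first exact: leq_addr.
    by rewrite -addnS => r Lr; apply/Ln/sub_add_gen.
(* If [g] is locally in every L_n, adding it changes nothing. Otherwise, past N, the coefficient [c]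
   of [g] must lie in P, and then cg is locally in K. *)
have [gL|/existsNP[N gLN]] := pselect (forall n, sat P (L n) g).
  have [n _ Ln] := Lg 0%N; exists n => r /Ln[s Ps [c Lr]].
  have [t Pt Lt] := gL n.+1.
  exists (t * s) => [/PM[]//|].
  rewrite (_ : _ * r = t * (s * r - c * g) + c * (t * g)); last by ring.
  by apply: (idL _).2 => //; exact: idealM.
have [n Nn Ln] := Lg N; exists n => r Lr; have [s Ps [c Lc]] := Ln r Lr.
have Pc : P c.
  apply: contrapT => Pc; apply: gLN; exists c => //.
  apply: (Lmono _ _ Nn); apply: (idealBr (idL n) (Ldec _ _ Lc)).
  exact: idealM.
have [t Pt Kt] := Pg c Pc.
exists (t * s) => [/PM[]//|].
rewrite (_ : _ * r = t * (s * r - c * g) + t * (c * g)); last by ring.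
by apply: (idL _).2 => //; exact: KL.
Qed.

(* Krull's principal ideal theorem. With I_n = {r | x^j r in A + (y^n)} and   *)
(* y in Q outside A, multiplication by x is injective modulo I_n, so the      *)
(* chain condition modulo x puts y^n into I_{n+1} up to a factor outside P;   *)
(* cancelling y^n would force x into Q.                                       *)
Lemma principal_ideal_thm A Q P x :
  prime A -> prime Q -> prime P -> A `<=` Q -> ~ Q `<=` A -> Q `<=` P ->
  P x -> ~ Q x ->
  exists P', [/\ prime P', A `<=` P', P' x, P' `<=` P & ~ P `<=` P'].
Proof.
move=> prA prQ prP AQ QA QP Px Qx.
have [idA _ AM] := prA; have [idQ _ QM] := prQ; have [idP P1 PM] := prP.
apply: contrapT => noP'.
have [y Qy Ay] : exists2 y, Q y & ~ A y.
  apply: contrapT => H; apply: QA => y Qy.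
  by apply: contrapT => Ay; apply: H; exists y.
pose I n : set R := [set r | exists j, add_gen A (y ^+ n) (x ^+ j * r)].
have idAy n : ideal (add_gen A (y ^+ n)) by exact: ideal_add_gen.
have Ishift n i j r : add_gen A (y ^+ n) (x ^+ j * r) ->
    add_gen A (y ^+ n) (x ^+ (i + j) * r).
  by move=> Ir; rewrite exprD -mulrA; exact: idealM.
have idI n : ideal (I n).
  split=> [|a u v [i Iu] [j Iv]].
    by exists 0%N; rewrite mulr0; exact: ideal0 (idAy n).
  exists (i + j)%N; rewrite mulrDr mulrCA; apply: (idAy n).2.
    by rewrite addnC; exact: Ishift.
  exact: Ishift.
have AI n : A `<=` I n.
  by move=> r Ar; exists 0%N; rewrite mul1r; exact: sub_add_gen.
have Idec n : I n.+1 `<=` I n.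
  move=> r [j [c Ir]]; exists j, (c * y).
  by rewrite -mulrA -exprS.
have Ix n r : I n (x * r) -> I n r.
  by move=> [j Ir]; exists j.+1; rewrite exprSr -mulrA.
have Iy n : I n (y ^+ n).
  by exists 0%N; rewrite mul1r; exact: add_gen_id.
(* By [noP'], P is minimal over A + (x), so the chain condition applies to the ideals I_n + (x). *)
have [n Ln] : exists n, add_gen (I n) x `<=` sat P (add_gen (I n.+1) x).
  apply: (@dcc_over_minimal_prime (add_gen A x) P) => //.
  - exact: ideal_add_gen.
  - move=> P' prP' AP' P'P; apply: contrapT => PP'; apply: noP'.
    exists P'; split=> //; last by apply: AP'; exact: add_gen_id.
    by move=> r Ar; apply/AP'/sub_add_gen.
  - by move=> n; exact: ideal_add_gen.
  - by move=> n r [c Ar]; exists c; exact: AI.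
  - by move=> n r [c Ir]; exists c; exact: Idec.
have [l Il] : exists l, forall r, I n r -> add_gen A (y ^+ n) (x ^+ l * r).
  have [|j|l Il] :=
      @ideal_chain_stable (fun j => [set r | add_gen A (y ^+ n) (x ^+ j * r)]).
  - move=> j; rewrite (_ : mkset _ = [set r | add_gen A (y ^+ n) (r * x ^+ j)]).
      exact: ideal_colon.
    by apply/funext => r; rewrite /mkset mulrC.
  - by move=> r /= Ir; rewrite exprS -mulrA; exact: idealM.
  - by exists l => r [j Ir]; exact: (Il j).
have Iapprox k r : I n r ->
    exists s t, [/\ ~ P s, I n t & I n.+1 (s * r - x ^+ k * t)].
  move=> Ir; elim: k => [|k [s [t [Ps It Ist]]]].
    by exists 1, r; split=> //; rewrite !mul1r subrr; exact: ideal0 (idI _).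
  have [|s' Ps' [e Ie]] := Ln t; first exact: sub_add_gen.
  exists (s' * s), e; split=> [/PM[]//||].
    apply: Ix; rewrite mulrC.
    by apply: (idealBr (idI n) (Idec _ _ Ie)); exact: idealM (idI n) _ _ It.
  rewrite (_ : _ - _ = s' * (s * r - x ^+ k * t) + x ^+ k * (s' * t - e * x)).
    by apply: (idI _).2 => //; exact: idealM (idI _) _ _ Ie.
  by rewrite exprSr; ring.
(* The exponent [l.+1] leaves one factor x after x^l t is replaced by w y^n modulo A; since x is in
   P and s is not, s - xw stays outside P. *)
have [s [t [Ps It Iyt]]] := Iapprox l.+1 _ (Iy n).
have [w Aw] := Il t It.
have [j [e]] : I n.+1 ((s - x * w) * y ^+ n).
  rewrite (_ : _ * _ = (s * y ^+ n - x ^+ l.+1 * t)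
     + x * (x ^+ l * t - w * y ^+ n)); last by rewrite exprS; ring.
  by apply: (idealD (idI _)) => //; apply/AI/(idealM idA).
rewrite (_ : _ - _ = y ^+ n * (x ^+ j * (s - x * w) - e * y)); last first.
  by rewrite exprS; ring.
move=> /AM[/(primeX prA)//|/AQ/(idealBl idQ)].
move=> /(_ (idealM idQ e Qy))/QM[/(primeX prQ)//|/QP Psw].
by apply/Ps/(idealBl idP Psw); rewrite mulrC; exact: idealM.
Qed.

End Noetherian.

(** * Chains of primes, height and prime avoidance *)

Section Height.
Local Open Scope classical_set_scope.
Variable R : comNzRingType.
Hypothesis noethR : noetherian R.
Implicit Types (I J P Q : set R) (x : R) (xs : seq R) (Ps : seq (set R)).

(** Both ends are parameters: the height bound fixes P and moves Q upwards. *)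
Fixpoint pchain n Q P : Prop :=
  prime P /\
  if n is n'.+1 then exists P', [/\ pchain n' Q P', P' `<=` P & ~ P `<=` P']
  else P = Q.

Lemma pchain_prime n Q P : pchain n Q P -> prime P.
Proof. by case: n => [|n] []. Qed.

Lemma pchain_sub n Q P : pchain n Q P -> Q `<=` P.
Proof.
elim: n P => [P [_ ->]//|n IHn P [_ [P' [/IHn QP' P'P _]]]].
exact: subset_trans P'P.
Qed.

(* Elements of the top prime can be pushed down a chain: if x is in P_{i+1}   *)
(* but not in P_i, the principal ideal theorem replaces P_i by a prime        *)
(* containing x.                                                              *)
Lemma pchain_step n Q P x : pchain n.+1 Q P -> P x ->
  exists Q', [/\ Q `<=` Q', Q' x & pchain n Q' P].
Proof.
elim: n P => [|n IHn] P [prP [P' [ch P'P PP']]] Px.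
  by case: ch => _ P'Q; subst P'; exists P.
have [P'x|P'x] := pselect (P' x).
  have [Q' [QQ' Q'x ch']] := IHn _ ch P'x.
  by exists Q'; split=> //; split=> //; exists P'.
have [prP' [A [chA AP' P'A]]] := ch.
have [N [prN AN Nx NP PN]] :=
  principal_ideal_thm noethR (pchain_prime chA) prP' prP AP' P'A P'P Px P'x.
have [|Q' [QQ' Q'x ch']] := IHn N _ Nx.
  by split=> //; exists A; split=> // NA; apply/P'x/AP'/NA.
by exists Q'; split=> //; split=> //; exists N.
Qed.

(** Each x raises the bottom of the chain to a prime containing it, at the cost of one step; when
    all are used up, minimality of P leaves no step. *)
Lemma pchain_height xs n Q P : pchain n Q P ->
  (forall x, x \in xs -> P x) ->
  (forall P', prime P' -> Q `<=` P' -> (forall x, x \in xs -> P' x) ->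
     P' `<=` P -> P `<=` P') ->
  (n <= size xs)%N.
Proof.
elim: xs n Q => [|x xs IHxs] n Q ch Pxs minP.
  case: n ch => // n [_ [P' [ch P'P PP']]]; exfalso; apply: PP'.
  apply: minP => //; first exact: pchain_prime ch.
  exact: pchain_sub ch.
case: n ch => // n ch.
have [|Q' [QQ' Q'x ch']] := pchain_step ch (x := x).
  by apply: Pxs; rewrite mem_head.
apply: (IHxs n Q') => // [z zxs|P' prP' Q'P' P'xs].
  by apply: Pxs; rewrite inE zxs orbT.
apply: minP => // [|z]; first exact: subset_trans Q'P'.
by rewrite inE => /predU1P[->|/P'xs//]; exact: Q'P'.
Qed.

(** If ab is in I, a prime over I contains I + (a) or I + (b), and (I + (a))(I + (b)) lies in I, so
    lists for the two larger ideals concatenate. The list may contain redundant primes. *)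
Lemma finitely_many_minimal_primes I : ideal I -> exists Ps,
  [/\ {in Ps, forall P, prime P /\ I `<=` P},
      (forall P, prime P -> I `<=` P -> exists2 P', P' \in Ps & P' `<=` P)
    & forall r, {in Ps, forall P : set R, P r} -> exists n, I (r ^+ n)].
Proof.
move: I; apply: (noetherian_ind noethR) => I idI IH.
have [I1|I1] := pselect (I 1).
  exists [::]; split=> // [P [_ P1 _] IP|r _]; last by exists 0%N.
  by case: P1; exact: IP.
have [prI|nprI] := pselect (prime I).
  exists [:: I]; split=> [P|P prP IP|r /(_ I)].
  - by rewrite mem_seq1 => /eqP->; split.
  - by exists I; rewrite ?mem_head.
  - by rewrite mem_head => Ir; exists 1%N; apply: Ir.
have [a [b [Iab Ia Ib]]] : exists a b, [/\ I (a * b), ~ I a & ~ I b].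
  apply: contrapT => H; apply: nprI; split=> // a b Iab.
  by apply: contrapT => /not_orP[Ia Ib]; apply: H; exists a, b.
have IHg g : ~ I g -> exists Ps,
    [/\ {in Ps, forall P, prime P /\ add_gen I g `<=` P},
      (forall P, prime P -> add_gen I g `<=` P ->
         exists2 P', P' \in Ps & P' `<=` P)
    & forall r, {in Ps, forall P : set R, P r} ->
         exists n, add_gen I g (r ^+ n)].
  move=> Ig; apply: IH; [exact: ideal_add_gen | exact: sub_add_gen |].
  by move=> /(_ g (add_gen_id g idI)).
have [[Pa [aP aMin aRad]] [Pb [bP bMin bRad]]] := (IHg a Ia, IHg b Ib).
exists (Pa ++ Pb); split=> [P|P prP IP|r Pr].
- rewrite mem_cat => /orP[/aP|/bP] [prP gP]; split=> // r Ir;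
    exact/gP/sub_add_gen.
- have [idP _ PM] := prP; case: (PM _ _ (IP _ Iab)) => [Pa1|Pb1].
    have [P' P'a P'P] := aMin _ prP (add_gen_sub idP IP Pa1).
    by exists P' => //; rewrite mem_cat P'a.
  have [P' P'b P'P] := bMin _ prP (add_gen_sub idP IP Pb1).
  by exists P' => //; rewrite mem_cat P'b orbT.
- have [|k Ik] := aRad r; first by move=> P Pa1; apply: Pr; rewrite mem_cat Pa1.
  have [|l Il] := bRad r.
    by move=> P Pb1; apply: Pr; rewrite mem_cat Pb1 orbT.
  by exists (k + l)%N; rewrite exprD; exact: add_gen_mul Iab Ik Il.
Qed.

Lemma mul_avoid Ps I P : ideal I -> prime P -> ~ I `<=` P ->
  {in Ps, forall Q, ideal Q /\ ~ Q `<=` P} ->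
  exists r, [/\ I r, {in Ps, forall Q : set R, Q r} & ~ P r].
Proof.
move=> idI [idP P1 PM] /existsNP[z /not_implyP[Iz Pz]].
elim: Ps => [|Q Ps IHPs] PsP; first by exists z.
have [|r [Ir Psr Pr]] := IHPs.
  by move=> Q' Q'Ps; apply: PsP; rewrite inE Q'Ps orbT.
have [idQ /existsNP[q /not_implyP[Qq Pq]]] := PsP Q (mem_head _ _).
exists (q * r); split=> [|Q'|/PM[]//]; first exact: idealM.
rewrite inE => /predU1P[->|Q'Ps]; first by rewrite mulrC; exact: idealM.
have [|idQ' _] := PsP Q'; first by rewrite inE Q'Ps orbT.
by apply: idealM => //; exact: Psr.
Qed.

(** Primes inside P are avoided along with P, so they are dropped. If x avoids the others, and r in
    I lies in all the others but not in P, then x or x + r works. *)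
Lemma prime_avoidance Ps I : ideal I ->
  {in Ps, forall P, prime P /\ ~ I `<=` P} ->
  exists2 x, I x & {in Ps, forall P : set R, ~ P x}.
Proof.
move=> idI; have [n] := ubnP (size Ps); elim: n Ps => // n IHn [|P Ps] /=.
  by move=> _ _; exists 0 => //; exact: ideal0.
rewrite ltnS => szPs PsI; have [prP IP] := PsI P (mem_head _ _).
pose Ps' := [seq Q <- Ps | `[< ~ Q `<=` P >]].
have Ps'I : {in Ps', forall Q, prime Q /\ ~ I `<=` Q}.
  move=> Q; rewrite mem_filter => /andP[_ QPs].
  by apply: PsI; rewrite inE QPs orbT.
have [|x Ix Ps'x] := IHn Ps' _ Ps'I.
  by apply: leq_ltn_trans szPs; rewrite size_filter count_size.
have [|r [Ir Ps'r Pr]] := @mul_avoid Ps' I P idI prP IP.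
  move=> Q QPs'; have [[idQ _ _] _] := Ps'I Q QPs'; split=> //.
  by move: QPs'; rewrite mem_filter => /andP[/asboolP].
suff [y Iy [Py Ps'y]] :
    exists2 y, I y & ~ P y /\ {in Ps', forall Q : set R, ~ Q y}.
  exists y => // Q; rewrite inE => /predU1P[->//|QPs].
  have [QP|QP] := pselect (Q `<=` P); first by move/QP.
  by apply: Ps'y; rewrite mem_filter QPs andbT; apply/asboolP.
have [Px|Px] := pselect (P x); last by exists x.
have [idP _ _] := prP.
exists (x + r); first exact: idealD.
split=> [Pxr|Q QPs'].
  by apply: Pr; rewrite -[r](addKr x) addrC; exact: idealB.
have [[idQ _ _] _] := Ps'I Q QPs'.
move=> Qxr; apply: (Ps'x Q QPs'); rewrite -[x](addrK r).
by apply: idealB => //; exact: Ps'r.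
Qed.

End Height.

(** * Systems of parameters *)

Section LocalRing.
Local Open Scope classical_set_scope.
Variable R : comNzRingType.
Implicit Types (I P Q : set R) (J : submodClosed R^o) (x r : R) (xs : seq R).

Definition idset (S : {pred R}) : set R := [set r | r \in S].

Lemma ideal_idset J : ideal (idset J).
Proof.
split=> [|a u v Ju Jv]; first exact: (rpred0 J).
exact: (submod_closed_mem J).2.
Qed.

Lemma mem_ideal_gen x xs : x \in xs -> x \in ideal_gen xs.
Proof. exact: mem_submod_span. Qed.

Lemma ideal_genP P xs : ideal P ->
  idset (ideal_gen xs) `<=` P <-> (forall x, x \in xs -> P x).
Proof.
move=> idP; split=> [gP x xxs|xsP r]; first exact/gP/mem_ideal_gen.
move=> /asboolP/(_ [pred r | `[< P r >]]) H; apply/asboolP/H.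
  split=> [|a u v /asboolP Pu /asboolP Pv]; apply/asboolP; first exact: ideal0.
  exact: idP.2.
by move=> x /xsP Px; apply/asboolP.
Qed.

Lemma idealr_closedP I :
  ideal I -> ~ I 1 -> idealr_closed [pred r | `[< I r >]].
Proof.
move=> idI I1; split; first by apply/asboolP; exact: ideal0.
  by apply/asboolP.
by move=> a u v /asboolP Iu /asboolP Iv; apply/asboolP; exact: idI.2.
Qed.

Lemma prime_idealP (S : {pred R}) : prime_ideal S <-> prime (idset S).
Proof.
split=> [[[S0 S1 SD] SM]|[[S0 SD] S1 SM]].
  split; [by split=> // a u v; exact: SD | exact/negP |].
  by move=> a b /SM/orP.
split; last by move=> a b /SM/orP.
by split=> [//||a u v]; [exact/negP | exact: SD].
Qed.

Lemma prime_chain_pchain k :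
  prime_chain R k <-> exists Q P, @pchain R k Q P.
Proof.
split=> [[P [prP Pinc]]|[Q [P]]].
  exists (idset (P 0%N)), (idset (P k)).
  elim: k prP Pinc => [|k IHk] prP Pinc /=.
    by split=> //; apply/prime_idealP/prP.
  split; first exact/prime_idealP/prP.
  exists (idset (P k)); have [PkS PSk] := Pinc k (leqnn _).
  split=> //; apply: IHk => i ik; first exact/prP/leqW.
  exact/Pinc/leqW.
move=> ch; suff [F [prF Finc _]] : exists F : nat -> {pred R},
    [/\ forall i, (i <= k)%N -> prime_ideal (F i),
        forall i, (i < k)%N -> {subset F i <= F i.+1} /\
          ~ {subset F i.+1 <= F i} & idset (F k) = P] by exists F.
pose bset (S : set R) : {pred R} := fun r => `[< S r >].
have asP (S : set R) : idset (bset S) = S.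
  by apply/seteqP; split=> r /asboolP.
elim: k P ch => [|k IHk] P [prP ch].
  exists (fun=> bset P); split=> //.
  by move=> i _; apply/prime_idealP; rewrite asP.
have [P' [/IHk[F [prF Finc FP']] P'P PP']] := ch.
exists (fun i => if (i <= k)%N then F i else bset P).
split=> [i ik|i|]; last by rewrite ltnn asP.
  case: leqP => [/prF//|ki]; by apply/prime_idealP; rewrite asP.
rewrite ltnS => ik; rewrite ik; case: (ltnP i k) => [/Finc//|ki].
have -> : i = k by apply/eqP; rewrite eqn_leq ik.
split=> [r Fr|FP]; first by apply/asboolP/P'P; rewrite -FP'.
by apply: PP' => r Pr; rewrite -FP'; apply/FP/asboolP.
Qed.

Variable m : submodClosed R^o.
Hypothesis locR : complete_local_ring m.

Let noethR : noetherian R := complete_local_noetherian locR.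

(** Noetherian induction in place of Zorn's lemma: a proper ideal that is not maximal has a larger
    proper ideal above it. *)
Lemma proper_sub_max I : ideal I -> ~ I 1 -> I `<=` idset m.
Proof.
move: I; apply: (noetherian_ind noethR) => I idI IH I1.
have [maxI|nmaxI] := pselect (maximal_ideal [pred r | `[< I r >]]).
  move=> r Ir; rewrite /idset /= -(complete_local_unique locR maxI).
  exact/asboolP.
have [S [clS IS nSI]] : exists S : {pred R},
    [/\ idealr_closed S, I `<=` idset S & ~ idset S `<=` I].
  apply: contrapT => H; apply: nmaxI; split; first exact: idealr_closedP.
  move=> S clS IS r; apply/idP/idP => [Sr|/IS//]; apply/asboolP.
  apply: contrapT => Ir; apply: H; exists S; split=> // [t It|/(_ r Sr)//].
  exact/IS/asboolP.
have [S0 S1 SD] := clS.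
apply: (subset_trans IS); apply: IH => //; last exact/negP.
Qed.

Lemma max_proper : ~ idset m 1.
Proof. by apply/negP; case: (complete_local_maximal locR).1. Qed.

Lemma notin_max_unit r : r \notin m -> exists c, c * r = 1.
Proof.
move=> rm; apply: contrapT => nu; move/negP: rm; apply.
have id0 : ideal [set 0 : R].
  by split=> // a u v -> ->; rewrite mulr0 addr0.
apply: (proper_sub_max (ideal_add_gen r id0)); last exact: add_gen_id.
by move=> [c /eqP]; rewrite subr_eq0 => /eqP e; apply: nu; exists c.
Qed.

Lemma prime_max : prime (idset m).
Proof.
split; [exact: ideal_idset | exact: max_proper |] => a b mab.
have [ma|/notin_max_unit[c ca]] := boolP (a \in m); first by left.
right; rewrite -[b]mul1r -ca -mulrA; apply: idealM => //.
exact: ideal_idset.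
Qed.

(** The given chain bounds the dimension below. Any chain can have its top replaced by m, the only
    prime containing [xs], so [pchain_height] bounds it above. *)
Lemma krull_dim_sop xs :
  (exists Q, @pchain R (size xs) Q (idset m)) ->
  radical (ideal_gen xs) =i m -> sop m xs.
Proof.
move=> [Q ch] radm; split=> //; split.
  by apply/prime_chain_pchain; exists Q, (idset m).
move=> k /prime_chain_pchain[Q' [P chP]].
have xsm x : x \in xs -> idset m x.
  move=> xxs; rewrite /idset /= -radm; apply/asboolP; exists 1%N.
  exact: mem_ideal_gen.
have [idP P1 PM] := pchain_prime chP.
have Pm : P `<=` idset m by exact: proper_sub_max.
have [Q'' chm] : exists Q, pchain k Q (idset m).
  case: k chP => [|k] chP.
    by exists (idset m); split=> //; exact: prime_max.
  exists Q'; split; first exact: prime_max.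
  have [_ [P' [ch' P'P PP']]] := chP; exists P'; split=> //.
    exact: subset_trans Pm.
  by move=> mP'; apply/PP'/(subset_trans Pm).
apply: (pchain_height noethR chm xsm) => P' prP' _ P'xs _ r.
rewrite /idset /= -radm => /asboolP[n rn]; apply: (primeX prP' (n := n)).
by have [idP' _ _] := prP'; apply: ((ideal_genP xs idP').2 P'xs).
Qed.

(* Successive elements avoid every minimal prime other than m of the ideal    *)
(* generated so far, so each one lengthens the prime chains below any prime   *)
(* containing them all.                                                       *)
Lemma extend_to_sop xs :
  (forall x, x \in xs -> x \in m) ->
  (forall P, prime P -> (forall x, x \in xs -> P x) ->
     exists Q, pchain (size xs) Q P) ->
  partial_sop m xs.
Proof.
have [I defI] : exists I, I = idset (ideal_gen xs).
  by exists (idset (ideal_gen xs)).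
have idI : ideal I by rewrite defI; exact: ideal_idset.
move: I idI xs defI; apply: (noetherian_ind noethR).
move=> I idI IH xs defI xsm xsch.
have [Ps [PsP Psmin Psrad]] := finitely_many_minimal_primes noethR idI.
have Pxs P : prime P -> I `<=` P <-> (forall x, x \in xs -> P x).
  by move=> [idP _ _]; rewrite defI; exact: ideal_genP.
have Psub P : prime P -> P `<=` idset m.
  by move=> [idP P1 _]; exact: proper_sub_max.
pose Ps' := [seq P <- Ps | `[< ~ idset m `<=` P >]].
have Ps'P P : P \in Ps' -> [/\ P \in Ps, prime P, I `<=` P & ~ idset m `<=` P].
  by rewrite mem_filter => /andP[/asboolP mP PPs]; have [] := PsP P PPs.
have [Ps'0|[p0 p0Ps']] : Ps' = [::] \/ exists p0, p0 \in Ps'.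
- by case: Ps' {Ps'P} => [|p0 ?]; [left | right; exists p0; rewrite mem_head].
(* Every listed prime contains m, so each element of m has a power in I. *)
- exists [::]; rewrite cats0; apply: krull_dim_sop.
    by apply: xsch prime_max _ => x /xsm.
  move=> r; apply/asboolP/idP => [[n rn]|mr].
    apply: (primeX prime_max (n := n)); move: (r ^+ n) rn.
    by apply/(ideal_genP xs (ideal_idset m)) => x /xsm.
  have [|n rn] := Psrad r; last by exists n; move: rn; rewrite defI.
  move=> P PPs; apply: contrapT => Pr.
  have : P \in Ps' by rewrite mem_filter PPs andbT; apply/asboolP => /(_ r mr).
  by rewrite Ps'0.
have [z mz Ps'z] := prime_avoidance (ideal_idset m)
  (fun P PPs' => let: And4 _ prP _ mP := Ps'P P PPs' in conj prP mP).
have [_ prp0 Ip0 mp0] := Ps'P _ p0Ps'.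
have genS : I `<=` idset (ideal_gen (rcons xs z)).
  rewrite defI; apply/ideal_genP; first exact: ideal_idset.
  by move=> x xxs; apply: mem_ideal_gen; rewrite mem_rcons inE xxs orbT.
have [||x|P prP PxsZ|ys sopys] :=
  IH _ (ideal_idset (ideal_gen (rcons xs z))) _ _ (rcons xs z) erefl.
- exact: genS.
- move=> /(_ z) Iz; apply: (Ps'z p0 p0Ps'); apply/Ip0/Iz.
  by apply: mem_ideal_gen; rewrite mem_rcons mem_head.
- by rewrite mem_rcons inE => /predU1P[->|/xsm].
(* A prime over I strictly below P: [p0] if P is m, otherwise a listed prime inside P, which misses
   [z]. *)
- have [P' [prP' IP' P'P PP']] :
      exists P', [/\ prime P', I `<=` P', P' `<=` P & ~ P `<=` P'].
    have [mP|mP] := pselect (idset m `<=` P).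
      exists p0; split=> //; first exact: subset_trans (Psub _ prp0) mP.
      by move=> Pp0; apply/mp0/(subset_trans mP).
    have [|P' P'Ps P'P] := Psmin P prP.
      apply/(Pxs P prP) => x xxs; apply: PxsZ.
      by rewrite mem_rcons inE xxs orbT.
    have P'Ps' : P' \in Ps'.
      by rewrite mem_filter P'Ps andbT; apply/asboolP => /subset_trans/(_ P'P).
    have [_ prP' IP' _] := Ps'P _ P'Ps'.
    exists P'; split=> // /(_ z) PP'; apply: (Ps'z _ P'Ps'); apply/PP'/PxsZ.
    by rewrite mem_rcons mem_head.
  have [Q chQ] := xsch P' prP' ((Pxs P' prP').1 IP').
  by exists Q; rewrite size_rcons; split=> //; exists P'.
by exists (z :: ys); rewrite -cat_rcons.
Qed.

End LocalRing.

Section DomainSop.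
Local Open Scope classical_set_scope.

(** In a domain the zero ideal is a prime strictly below every prime containing x. *)
Lemma partial_sop1 (R : idomainType) (m : submodClosed R^o) (x : R) :
  complete_local_ring m -> x \in m -> x != 0 -> partial_sop m [:: x].
Proof.
move=> locR mx x0; apply: (extend_to_sop locR) => [y|P prP Px].
  by rewrite mem_seq1 => /eqP->.
have pr0 : prime [set 0 : R].
  split=> [|/eqP|a b /eqP]; last 2 first.
  - by rewrite oner_eq0.
  - by rewrite mulf_eq0 => /orP[] /eqP; [left|right].
  by split=> // a u v -> ->; rewrite mulr0 addr0.
exists [set 0]; split=> //; exists [set 0]; split=> //.
  by move=> _ ->; exact: ideal0 (prime_is_ideal prP).
by move=> /(_ x (Px x (mem_head _ _)))/eqP; rewrite (negPf x0).
Qed.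

End DomainSop.

(** * Closures of m and 0 over a big Cohen-Macaulay module *)

Section BigCM.
Variables (R : idomainType) (m : submodClosed R^o) (B : lmodType R).
Hypotheses (locR : complete_local_ring m) (cmB : balanced_big_CM m B).

Lemma big_CM_natcl_max : natcl B m =i m.
Proof.
move=> u; apply/idP/idP; last exact: sub_natcl.
move=> um; have [//|/(notin_max_unit locR)[c cu]] := boolP (u \in m).
case: cmB.2 => b; rewrite [RHS]inE.
have -> : b = u *: (c *: b) by rewrite scalerA mulrC cu scale1r.
exact: natcl_ideal.
Qed.

Lemma submod_mul0 (J : submodClosed R^o) (b : B) : {subset J <= pred1 0} ->
  b \in submod_mul J (predT : {pred B}) -> b = 0.
Proof.
move=> J0 bJ; apply/eqP; rewrite -mem_zero_submod; move: b bJ.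
apply: submod_span_sub => _ /asboolP[r [c [/J0/eqP-> _ ->]]].
by rewrite scale0r mem_zero_submod.
Qed.

Lemma big_CM_faithful (u : R) : (forall b : B, u *: b = 0) -> u = 0.
Proof.
move=> uB; apply/eqP; apply: contrapT => /negP u0; case: cmB.2 => b.
suff -> : b = 0 by rewrite rpred0.
have [um|/(notin_max_unit locR)[c cu]] := boolP (u \in m); last first.
  by rewrite -[b]scale1r -cu -scalerA uB scaler0.
(* Regularity after the empty sequence: ub = 0 puts b in (0)B = 0. *)
have := cmB.1 [::] u b (partial_sop1 locR um u0).
rewrite uB rpred0 => /(_ isT); apply: submod_mul0.
by apply: (submod_span_sub (N := zero_submod R^o)).
Qed.

Lemma big_CM_natcl0 : natcl B (zero_submod R^o) =i zero_submod R^o.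
Proof.
move=> u; apply/idP/idP => [u0|]; last exact: sub_natcl.
rewrite mem_zero_submod; apply/eqP/big_CM_faithful => b.
by apply: submod_mul0 (natcl_ideal b u0).
Qed.

End BigCM.

Theorem theorem4p2 (R : idomainType) (m : submodClosed R^o) (B : lmodType R)
    (locR : complete_local_ring m) (cmB : balanced_big_CM m B) :
  (* (1) *)
  (forall (M : lmodType R) (N : submodClosed M),
     fin_gen (predT : {pred M}) -> fin_gen N ->
     submod_closed (natcl B N) /\ {subset N <= natcl B N}) /\
  (* (2) *)
  (forall (M : lmodType R) (N : submodClosed M),
     fin_gen (predT : {pred M}) -> fin_gen N ->
     forall clN : submod_closed (natcl B N),
       natcl B (Submod clN) =i natcl B N) /\
  (* (3) *)
  (forall (W : lmodType R) (N M : submodClosed W),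
     fin_gen (predT : {pred W}) -> fin_gen N -> fin_gen M ->
     {subset N <= M} -> {subset natcl B N <= natcl B M}) /\
  (* (4) *)
  (forall (M W : lmodType R) (N : submodClosed M) (f : {linear M -> W}),
     fin_gen (predT : {pred M}) -> fin_gen (predT : {pred W}) -> fin_gen N ->
     forall u, u \in natcl B N -> f u \in natcl B (submod_image f N)) /\
  (* (5) *)
  (forall (M : lmodType R) (N : submodClosed M),
     fin_gen (predT : {pred M}) -> fin_gen N ->
     natcl B N =i N ->
     natcl B (zero_submod (quotmod N)) =i zero_submod (quotmod N)) /\
  (* (6) *)
  (natcl B m =i m /\ natcl B (zero_submod R^o) =i zero_submod R^o) /\
  (* (7) *)
  (forall (x : seq R) (y : R) (M : lmodType R)
      (f : {linear M -> quotmod (ideal_gen x)}) (v : M),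
     partial_sop m (rcons x y) -> fin_gen (predT : {pred M}) ->
     (forall q, exists u, f u = q) ->
     f v = quot_pi (ideal_gen x) y ->
     forall u, u \in natcl B (submod_span (pred1 v)) -> f u = 0 ->
       u \in natcl B (submod_mul (ideal_gen x) (pred1 v))).

Proof.
split=> [M N _ _|].
  by split; [exact: natcl_submod_closed | exact: sub_natcl].
split=> [M N _ _ clN|]; first exact: natcl_idem.
split=> [W N M _ _ _|]; first exact: natcl_mono.
split=> [M W N f _ _ _ u|]; first exact: natcl_image.
split=> [M N _ _|]; first exact: natcl_quot0.
split=> [|x y M f v xy _ _ fv]; last first.
  by apply: natcl_span1_colon fv => b; exact: cmB.1.
by split; [exact: big_CM_natcl_max | exact: big_CM_natcl0 locR cmB].
Qed.
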